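(* Let $(\mathcal A,\varphi)$ be a $*$-probability space and let $(c_l,c_r)$ be a bi-circular element pair in $(\mathcal A,\varphi)$. Then $(c_l,c_r)$ is an $R$-diagonal pair.
   Context: A $*$-probability space $(\mathcal A,\varphi)$ is a unital $*$-algebra $\mathcal A$ over $\mathbb C$ with a linear functional $\varphi$ such that $\varphi(1)=1$ and $\varphi(a^* )=\overline{\varphi(a)}$. For $\chi:\{1,\dots,n\}\to\{l,r\}$, the permutation $s_\chi$ of $\{1,\dots,n\}$ is defined by $\chi^{-1}(\{l\})=\{s_\chi(1)<\cdots<s_\chi(k)\}$ and $\chi^{-1}(\{r\})=\{s_\chi(k+1)>\cdots>s_\chi(n)\}$. The set of bi-non-crossing partitions is $BNC(\chi)=\{s_\chi\cdot\pi:\pi\in NC(n)\}$, where $NC(n)$ is the set of non-crossing partitions of $\{1,\dots,n\}$ and $s_\chi\cdot\pi$ is obtained by applying $s_\chi$ to the blocks of $\pi$. The bi-free cumulants $\kappa_\chi:\mathcal A^n\to\mathbb C$ are the multilinear functionals determined recursively by $\varphi(a_1\cdots a_n)=\sum_{\pi\in BNC(\chi)}\prod_{V\in\pi}\kappa_{\chi|_V}((a_1,\dots,a_n)|_V)$, where for $V=\{i_1<\dots<i_m\}$, $(a_1,\dots,a_n)|_V=(a_{i_1},\dots,a_{i_m})$ and $\chi|_V$ is regarded as a map on $\{1,\dots,m\}$ by order-preserving relabelling. Two pairs $(a_1,b_1)$, $(a_2,b_2)$ (first entries are left variables, second entries right variables) are bi-free if all mixed bi-free cumulants vanish: $\kappa_\chi(d_1,\dots,d_n)=0$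 whenever $n\ge2$, $\epsilon:\{1,\dots,n\}\to\{1,2\}$ is non-constant, and $d_k=a_{\epsilon(k)}$ if $\chi(k)=l$, $d_k=b_{\epsilon(k)}$ if $\chi(k)=r$. $R$-diagonal pair: $(x,y)$ in $(\mathcal A,\varphi)$ is $R$-diagonal if, for all $\chi:\{1,\dots,m\}\to\{l,r\}$ and all $z_1,\dots,z_m$ with $z_i\in\{x,x^*\}$ when $\chi(i)=l$ and $z_i\in\{y,y^*\}$ when $\chi(i)=r$, one has $\kappa_\chi(z_1,\dots,z_m)=0$ unless $m=2n$ is even and $(z_{s_\chi(1)},\dots,z_{s_\chi(2n)})=(x^{\omega(1)},\dots,x^{\omega(k)},y^{\omega(k+1)},\dots,y^{\omega(2n)})$ for some $0\le k\le 2n$ and some alternating $\omega:\{1,\dots,2n\}\to\{1,*\}$ (i.e. $\omega(i)\neq\omega(i+1)$ for all $i$). Bi-circular element pair: let $(z_{1,l},z_{1,r})$ and $(z_{2,l},z_{2,r})$ be two bi-free pairs of self-adjoint elements of $(\mathcal A,\varphi)$ having the same hermitian bi-free central limit distribution, i.e. there is a positive semidefinite matrix $C=(c_{i,j})_{i,j\in\{l,r\}}$ such that $\kappa_\chi(z_{i,\chi(1)},\dots,z_{i,\chi(n)})=\delta_{2,n}\,c_{\chi(1),\chi(2)}$ for $i=1,2$ and all $n$ and $\chi:\{1,\dots,n\}\to\{l,r\}$. Put $c_l=\frac1{\sqrt2}(z_{1,l}+\imath z_{2,l})$ and $c_r=\frac1{\sqrt2}(z_{1,r}+\imath z_{2,r})$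 with $\imath=\sqrt{-1}$. Any pair $(c_l,c_r)$ arising in this way is called a bi-circular element pair. *)

(* Defs.v *)
From HB Require Import structures.
From mathcomp Require Import all_boot all_order all_fingroup all_algebra.
From mathcomp Require Import reals.
From mathcomp.real_closed Require Import complex.

Set Implicit Arguments.
Unset Strict Implicit.
Unset Printing Implicit Defensive.

Import Order.TTheory GRing.Theory Num.Theory.

Local Open Scope ring_scope.

Variant side := Left | Right.

Definition bool_of_side (s : side) : bool := if s is Left then true else false.
Definition side_of_bool (b : bool) : side := if b then Left else Right.
Lemma bool_of_sideK : cancel bool_of_side side_of_bool. Proof. by case. Qed.
HB.instance Definition _ := Finite.copy side (can_type bool_of_sideK).

(* Positions are 'I_n = {0, ..., n-1} instead of {1, ..., n}. *)

Section Partitions.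
Variables (n : nat) (chi : 'I_n -> side).

Definition schi_seq : seq 'I_n :=
  [seq i <- enum 'I_n | chi i == Left] ++
  rev [seq i <- enum 'I_n | chi i == Right].

Lemma perm_schi_seq : perm_eq schi_seq (enum 'I_n).
Proof.
have e : predC (fun i => chi i == Left) =1 (fun i => chi i == Right).
  by move=> i /=; case: (chi i).
rewrite perm_sym -(permPl (permEl (perm_filterC (fun i => chi i == Left) _))).
by rewrite (eq_filter e) perm_cat2l perm_sym perm_rev.
Qed.

Lemma size_schi_seq : size schi_seq = n.
Proof. by rewrite (perm_size perm_schi_seq) size_enum_ord. Qed.

(* The default value of nth is never reached, by size_schi_seq. *)
Definition schi_fun (i : 'I_n) : 'I_n := nth i schi_seq i.

Lemma schi_fun_inj : injective schi_fun.
Proof.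
move=> i j; rewrite /schi_fun (set_nth_default j) ?size_schi_seq // => /eqP.
rewrite nth_uniq ?size_schi_seq // => [/eqP/val_inj //|].
by rewrite (perm_uniq perm_schi_seq) enum_uniq.
Qed.

Definition schi : {perm 'I_n} := perm schi_fun_inj.

Definition noncrossing (pi : {set {set 'I_n}}) : bool :=
  [forall V in pi, forall W in pi,
    [forall i in V, forall j in W, forall k in V, forall l in W,
      [&& i < j, j < k & k < l]%N ==> (V == W)]].

Definition NC : {set {set {set 'I_n}}} :=
  [set pi | partition pi [set: 'I_n] & noncrossing pi].

Definition BNC : {set {set {set 'I_n}}} :=
  [set [set schi @: (V : {set 'I_n}) | V in (pi : {set {set 'I_n}})] | pi in NC].

End Partitions.

Record star_prob_space (R : realType) (A : algType R[i]) := StarProbSpace {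
  star : A -> A;
  starK : involutive star;
  starD : forall a b, star (a + b) = star a + star b;
  starZ : forall (c : R[i]) a, star (c *: a) = c^* *: star a;
  starM : forall a b, star (a * b) = star b * star a;
  phi : {scalar A};
  phi1 : phi 1 = 1;
  phi_star : forall a, phi (star a) = (phi a)^*
}.

Section BiFree.
Variables (R : realType) (A : algType R[i]) (P : star_prob_space A).

(* For V : {set 'I_n}, the map enum_val : 'I_#|V| -> 'I_n is the increasing
   enumeration of V, so composing with it restricts to V and relabels.
   The moment-cumulant formula is solved for the cumulant of the partition with
   one block; all blocks of the other partitions have fewer than n elements, so
   that n steps of recursion suffice (see moment_cumulant). The first argument
   is this number of steps. *)
Fixpoint cumul_rec (k : nat) :
    forall n, ('I_n -> side) -> ('I_n -> A) -> R[i] :=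
  if k isn't k'.+1 then fun _ _ _ => 0 else
  fun n chi a =>
    phi P (\prod_(i < n) a i) -
    \sum_(pi in BNC chi | pi != [set [set: 'I_n]])
      \prod_(V in pi)
        cumul_rec k' (fun i : 'I_#|V| => chi (enum_val i))
                     (fun i : 'I_#|V| => a (enum_val i)).

(* kappa is meaningful for n > 0; it is 0 for n = 0. *)
Definition kappa (n : nat) (chi : 'I_n -> side) (a : 'I_n -> A) : R[i] :=
  cumul_rec n chi a.

(* First components are left variables, second ones right variables. *)
Definition entry (p : A * A) (s : side) : A := if s is Left then p.1 else p.2.

Definition bifree (p1 p2 : A * A) : Prop :=
  forall (n : nat) (chi : 'I_n -> side) (eps : 'I_n -> bool),
    (2 <= n)%N -> (exists i j, eps i != eps j) ->
    kappa chi (fun k => entry (if eps k then p2 else p1) (chi k)) = 0.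

(* b = false encodes the exponent 1 and b = true the exponent *. *)
Definition star_exp (b : bool) (a : A) : A := if b then star P a else a.

Definition alternating (m : nat) (w : 'I_m -> bool) : Prop :=
  forall i j : 'I_m, j = i.+1 :> nat -> w i != w j.

Definition r_diagonal (x y : A) : Prop :=
  forall (m : nat) (chi : 'I_m -> side) (z : 'I_m -> A),
    (forall i, z i = entry (x, y) (chi i) \/ z i = star P (entry (x, y) (chi i))) ->
    ~ (~~ odd m /\
       exists k : nat, exists w : 'I_m -> bool,
         [/\ (k <= m)%N, alternating w &
             forall i : 'I_m,
               z (schi chi i) = star_exp (w i) (if (i < k)%N then x else y)]) ->
    kappa chi z = 0.

(* On R[i], 0 <= u means that u is real and nonnegative. *)
Definition psd (c : side -> side -> R[i]) : Prop :=
  forall v : side -> R[i], 0 <= \sum_(s : side) \sum_(t : side) (v s)^* * c s t * v t.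

Definition central_limit (c : side -> side -> R[i]) (p : A * A) : Prop :=
  (forall chi : 'I_2 -> side,
     kappa chi (fun k => entry p (chi k)) = c (chi ord0) (chi ord_max)) /\
  (forall (n : nat) (chi : 'I_n -> side), n <> 2%N ->
     kappa chi (fun k => entry p (chi k)) = 0).

Definition bicircular (cl cr : A) : Prop :=
  exists (z1 z2 : A * A) (c : side -> side -> R[i]),
    [/\ (forall s, star P (entry z1 s) = entry z1 s) /\
        (forall s, star P (entry z2 s) = entry z2 s),
        bifree z1 z2,
        psd c,
        central_limit c z1 /\ central_limit c z2 &
        cl = (sqrtC 2)^-1 *: (z1.1 + 'i *: z2.1) /\
        cr = (sqrtC 2)^-1 *: (z1.2 + 'i *: z2.2)].

Lemma schi1_BNC n (chi : 'I_n.+1 -> side) : [set [set: 'I_n.+1]] \in BNC chi.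
Proof.
apply/imsetP; exists [set [set: 'I_n.+1]].
  rewrite inE; apply/andP; split.
    rewrite /partition /cover /trivIset /cover !big_set1 !eqxx inE /=.
    by rewrite eq_sym -card_gt0 cardsT card_ord.
  apply/forall_inP => V /set1P-> /=; apply/forall_inP => W /set1P-> /=.
  by do 4![apply/forall_inP => ? _]; rewrite eqxx implybT.
rewrite imset_set1; congr [set _]; apply/esym/setP => i; rewrite inE.
by apply/imsetP; exists ((schi chi)^-1%g i); rewrite ?inE ?permKV.
Qed.

Lemma BNC_partition n (chi : 'I_n -> side) pi :
  pi \in BNC chi -> partition pi [set: 'I_n].
Proof.
case/imsetP => rho; rewrite inE => /andP[prho _] ->.
have {1}-> : [set: 'I_n] = schi chi @: [set: 'I_n].
  apply/setP => i; rewrite inE; apply/esym/imsetP.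
  by exists ((schi chi)^-1%g i); rewrite ?inE ?permKV.
by rewrite imset_partition //; apply: perm_inj.
Qed.

Lemma BNC_block_lt n (chi : 'I_n -> side) pi V :
  pi \in BNC chi -> pi != [set [set: 'I_n]] -> V \in pi -> (#|V| < n)%N.
Proof.
move=> /BNC_partition pP pN1 Vpi; rewrite ltnNge; apply: contra pN1 => leV.
have VT : V = [set: 'I_n].
  by apply/eqP; rewrite eqEcard subsetT cardsT card_ord.
rewrite eqEsubset !sub1set -{2}VT Vpi andbT; apply/subsetP => W Wpi.
rewrite inE; apply: contraT => WN; case/and3P: pP => _ /trivIsetP tI n0.
have := tI W V Wpi Vpi; rewrite VT => /(_ WN).
rewrite -setI_eq0 setIT => /eqP W0; by rewrite -W0 Wpi in n0.
Qed.

Lemma cumul_rec_stable k k' n (chi : 'I_n -> side) a :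
  (n <= k)%N -> (n <= k')%N -> (0 < n)%N -> cumul_rec k chi a = cumul_rec k' chi a.
Proof.
elim: k k' n chi a => [|k IH] [|k'] n chi a; try by case: n chi a.
move=> nk nk' n0 /=; congr (_ - _); apply: eq_bigr => pi /andP[piB piN].
apply: eq_bigr => V Vpi; have ltV := BNC_block_lt piB piN Vpi.
apply: IH; [exact: leq_trans ltV nk|exact: leq_trans ltV nk'|].
case/and3P: (BNC_partition piB) => _ _ n0pi.
by rewrite card_gt0; apply: contra n0pi => /eqP <-.
Qed.

Lemma eq_cumul_rec k n (chi chi' : 'I_n -> side) a a' :
  chi =1 chi' -> a =1 a' -> cumul_rec k chi a = cumul_rec k chi' a'.
Proof.
elim: k n chi chi' a a' => [//|k IH] n chi chi' a a' echi ea /=.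
have eB : BNC chi = BNC chi'.
  rewrite /BNC; suff -> : schi chi = schi chi' by [].
  apply/permP => i; rewrite !permE /schi_fun /schi_seq.
  by congr (nth _ (_ ++ rev _) _); apply: eq_filter => j; rewrite echi.
rewrite eB; congr (phi P _ - _); first by apply: eq_bigr => i _.
by apply: eq_bigr => pi _; apply: eq_bigr => V _; apply: IH => i.
Qed.

Lemma eq_kappa_cast n m (e : m = n) (chi : 'I_n -> side) a chi' a' :
  (forall i, chi' i = chi (cast_ord e i)) -> (forall i, a' i = a (cast_ord e i)) ->
  @kappa m chi' a' = kappa chi a.
Proof.
subst m => hc ha; apply: eq_cumul_rec => i; rewrite ?hc ?ha cast_ord_id //.
Qed.

Theorem moment_cumulant n (chi : 'I_n.+1 -> side) (a : 'I_n.+1 -> A) :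
  phi P (\prod_(i < n.+1) a i) =
  \sum_(pi in BNC chi) \prod_(V in pi)
    kappa (fun i : 'I_#|V| => chi (enum_val i)) (fun i : 'I_#|V| => a (enum_val i)).
Proof.
rewrite (bigD1 _ (schi1_BNC chi)) /= big_set1.
have e : #|[set: 'I_n.+1]| = n.+1 by rewrite cardsT card_ord.
have eV i : enum_val i = cast_ord e i :> 'I_n.+1.
  rewrite (enum_val_nth ord0); apply: val_inj => /=.
  by rewrite enum_setT -enumT nth_enum_ord //; apply: leq_trans (ltn_ord i) _; rewrite e.
rewrite (eq_kappa_cast (e := e) (chi := chi) (a := a)); try by move=> i; rewrite eV.
rewrite [kappa chi a]/= -addrA -[LHS]addr0; congr (_ + _).
apply/esym/eqP; rewrite addrC subr_eq0; apply/eqP.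
apply: eq_bigr => pi /andP[piB piN]; apply: eq_bigr => V Vpi.
apply: cumul_rec_stable => //.
  by have := BNC_block_lt piB piN Vpi.
case/and3P: (BNC_partition piB) => _ _ n0pi.
by rewrite card_gt0; apply: contra n0pi => /eqP <-.
Qed.

End BiFree.

(* Main.v *)
(* The cumulants are multilinear, so a cumulant in c_l, c_r and their adjoints
   expands into cumulants in z_1 and z_2. Bi-freeness kills the mixed terms and
   the central limit condition kills all orders other than two. In order two
   the two pure terms agree up to the factors 1 and (+-i)(+-i), which cancel
   when the two exponents are equal; distinct exponents are alternating. *)

Require Import Defs.
From mathcomp Require Import all_boot all_order all_fingroup all_algebra.
From mathcomp Require Import boolp reals.
From mathcomp.real_closed Require Import complex.

Set Implicit Arguments.
Unset Strict Implicit.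
Unset Printing Implicit Defensive.

Import Order.TTheory GRing.Theory Num.Theory.

Local Open Scope ring_scope.

Section Multilinear.
Variables (K : comNzRingType) (V : lmodType K) (I : finType).

(** The three families are only required to agree off [j]. With no update operation involved, this
    form is inherited by the restriction to a block along [enum_val]. *)
Definition multilinear (F : (I -> V) -> K) : Prop :=
  forall (j : I) (a u v : I -> V) (c d : K),
    a j = c *: u j + d *: v j ->
    (forall i, i != j -> a i = u i) -> (forall i, i != j -> a i = v i) ->
    F a = c * F u + d * F v.

(** Generalised for induction on [s], the list of slots still to be expanded; [eps] records the
    choices already fixed in the other slots. *)
Lemma multilinear_expand_on (F : (I -> V) -> K) (c : I -> bool -> K)
    (b : I -> bool -> V) (s : seq I) (eps : {ffun I -> bool}) :
  multilinear F -> uniq s ->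
  F (fun i => if i \in s then c i true *: b i true + c i false *: b i false
              else b i (eps i)) =
  \sum_(f : {ffun I -> bool} | [forall i, (i \in s) || (f i == eps i)])
    (\prod_(i <- s) c i (f i)) * F (fun i => b i (f i)).
Proof.
move=> mF; elim: s eps => [|j s IH] eps /=.
  move=> _; rewrite (big_pred1 eps) ?big_nil ?mul1r // => f /=.
  apply/forallP/eqP => [h|-> i]; last by rewrite eqxx.
  by apply/ffunP => i; apply/eqP; have := h i.
case/andP=> js us.
pose upd e := [ffun i => if i == j then e else eps i].
rewrite (mF j _
  (fun i => if i \in s then c i true *: b i true + c i false *: b i false
            else b i (upd true i))
  (fun i => if i \in s then c i true *: b i true + c i false *: b i false
            else b i (upd false i)) (c j true) (c j false)); last first.
- by move=> i /negPf ij; rewrite inE ij !ffunE ij.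
- by move=> i /negPf ij; rewrite inE ij !ffunE ij.
- by rewrite inE eqxx /= (negPf js) !ffunE eqxx.
(* Split the choices by their value at the new slot [j]. Those with value [e] there are exactly the
   ones compatible with [upd e] off [s]. *)
rewrite !IH // [RHS](partition_big (fun f : {ffun I -> bool} => f j) predT) //=.
have agree e : (fun f : {ffun I -> bool} =>
    [forall i, (i \in s) || (f i == upd e i)]) =1
  (fun f => [forall i, (i \in j :: s) || (f i == eps i)] && (f j == e)).
  move=> f /=; apply/forallP/andP => [h|[/forallP h /eqP fj] i].
    split; last by have := h j; rewrite (negPf js) ffunE eqxx.
    apply/forallP => i; have := h i; rewrite inE ffunE.
    by case: (i == j).
  have := h i; rewrite inE ffunE; case: (i =P j) => [->|//] _.
  by rewrite fj eqxx orbT.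
rewrite big_bool /= (eq_bigl _ _ (agree true)) (eq_bigl _ _ (agree false)) !big_distrr /=.
by congr (_ + _); apply: eq_bigr => f /andP[_ /eqP fj];
  rewrite big_cons fj mulrA.
Qed.

Lemma multilinear_expand (F : (I -> V) -> K) (c : I -> bool -> K)
    (b : I -> bool -> V) :
  multilinear F ->
  F (fun i => c i true *: b i true + c i false *: b i false) =
  \sum_(f : {ffun I -> bool}) (\prod_i c i (f i)) * F (fun i => b i (f i)).
Proof.
move=> mF.
have := multilinear_expand_on c b [ffun=> true] mF (enum_uniq I).
have -> : (fun i => if i \in enum I then c i true *: b i true
             + c i false *: b i false else b i ([ffun=> true] i)) =
          (fun i => c i true *: b i true + c i false *: b i false).
  by apply/funext => i; rewrite mem_enum.
move=> ->; apply: eq_big => [f|f _]; last by rewrite big_enum.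
by apply/forallP => i; rewrite mem_enum.
Qed.

End Multilinear.

(** Since [s] is duplicate-free, [j] indexes exactly one factor; distributivity applies there and
    scalars move out past the other factors, without commutativity in [A]. *)
Lemma prod_slot (K : comNzRingType) (A : algType K) (I : eqType) (s : seq I)
    (j : I) (a u v : I -> A) (c d : K) :
  uniq s -> j \in s -> a j = c *: u j + d *: v j ->
  (forall i, i != j -> a i = u i) -> (forall i, i != j -> a i = v i) ->
  \prod_(i <- s) a i = c *: \prod_(i <- s) u i + d *: \prod_(i <- s) v i.
Proof.
move=> + + aj au av; elim: s => // i s IH /= /andP[is_ us].
rewrite inE !big_cons => /orP[/eqP ji|js].
  have ne k : k \in s -> k != j by move=> ks; apply: contraNneq is_ => kj; rewrite -ji -kj.
  have eu : \prod_(k <- s) u k = \prod_(k <- s) a k.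
    by apply: eq_big_seq => k /ne /au.
  have ev : \prod_(k <- s) v k = \prod_(k <- s) a k.
    by apply: eq_big_seq => k /ne /av.
  by rewrite eu ev -ji aj mulrDl !scalerAl.
have ij : i != j by apply: contraNneq is_ => ->.
by rewrite (IH us js) -(au i ij) -(av i ij) mulrDr !scalerAr.
Qed.

(** The permutation lists all left positions before the right ones, so the threshold in the
    definition of $R$-diagonality is the number of left positions. *)
Lemma schi_left n (chi : 'I_n -> side) (i : 'I_n) :
  (i < size [seq i <- enum 'I_n | chi i == Left])%N = (chi (schi chi i) == Left).
Proof.
rewrite permE /schi_fun; set L := [seq i <- _ | _]; rewrite nth_cat -/L.
case: ltnP => iL.
  by have := mem_nth i iL; rewrite mem_filter => /andP[->].
set r := rev _.
have : nth i r (i - size L) \in r.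
  by rewrite mem_nth // ltn_subLR // -size_cat -/(schi_seq chi) size_schi_seq.
by rewrite mem_rev mem_filter => /andP[/eqP->].
Qed.

Section Cumulants.
Variables (R : realType) (A : algType R[i]) (P : star_prob_space A).

(** In each partition exactly one block [W] contains slot [j]: its factor is multilinear by
    induction on the recursion depth, and the factors of the other blocks do not see the change at
    [j]. *)
Lemma cumul_rec_multilinear k n (chi : 'I_n -> side) :
  multilinear (cumul_rec P k chi).
Proof.
elim: k n chi => [|k IH] n chi j a u v c d aj au av /=.
  by rewrite !mulr0 addr0.
rewrite (@prod_slot _ _ _ _ j a u v c d) ?index_enum_uniq ?mem_index_enum //.
rewrite linearD !linearZ /= !mulrBr addrACA -opprD; congr (_ - _).
rewrite !mulr_sumr -big_split /=; apply: eq_bigr => pi /andP[piB _].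
have piP := BNC_partition piB; have [/eqP covP _ _] := and3P piP.
have jc : j \in cover pi by rewrite covP inE.
set W := pblock pi j; have Wpi : W \in pi by rewrite pblock_mem.
have jW : j \in W by rewrite mem_pblock.
rewrite !(bigD1 W Wpi) /=.
have off (g : 'I_n -> A) : (forall i, i != j -> a i = g i) ->
    \prod_(V in pi | V != W)
      cumul_rec P k (fun i : 'I_#|V| => chi (enum_val i))
                    (fun i : 'I_#|V| => g (enum_val i)) =
    \prod_(V in pi | V != W)
      cumul_rec P k (fun i : 'I_#|V| => chi (enum_val i))
                    (fun i : 'I_#|V| => a (enum_val i)).
  move=> ag; apply: eq_bigr => V /andP[Vpi VW].
  apply: eq_cumul_rec => // i; rewrite ag //; apply: contra VW => /eqP ij.
  rewrite eq_sym; apply/eqP/def_pblock => //; first by case/and3P: piP.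
  by rewrite -ij enum_valP.
rewrite (off u au) (off v av) !mulrA -mulrDl; congr (_ * _).
(* The slot that varies is the rank of [j] inside [W]. *)
apply: (IH _ _ (enum_rank_in jW j)); rewrite ?enum_rankK_in //.
  move=> i ij; apply: au; apply: contra ij => /eqP ij.
  by apply/eqP/enum_val_inj; rewrite enum_rankK_in.
move=> i ij; apply: av; apply: contra ij => /eqP ij.
by apply/eqP/enum_val_inj; rewrite enum_rankK_in.
Qed.

(** Of the terms of the multilinear expansion, only the two constant choices are not mixed
    cumulants. *)
Lemma kappa_bifree (p1 p2 : A * A) n (chi : 'I_n -> side) (c : 'I_n -> bool -> R[i]) :
  bifree P p1 p2 -> (0 < n)%N ->
  kappa P chi (fun i => c i true *: entry p2 (chi i) + c i false *: entry p1 (chi i)) =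
  (\prod_i c i true) * kappa P chi (fun i => entry p2 (chi i)) +
  (\prod_i c i false) * kappa P chi (fun i => entry p1 (chi i)).
Proof.
move=> free n0; pose b i (e : bool) := entry (if e then p2 else p1) (chi i).
rewrite /kappa (multilinear_expand c b (@cumul_rec_multilinear n n chi)).
(* Here [0 < n] matters: on an empty index set the two constant choices coincide. *)
have neq : [ffun=> false] != [ffun=> true] :> {ffun 'I_n -> bool}.
  by apply/eqP => /ffunP/(_ (Ordinal n0)); rewrite !ffunE.
rewrite (bigD1 [ffun=> true]) //= (bigD1 [ffun=> false]) //=.
rewrite [X in _ + (_ + X)]big1 ?addr0.
  by congr (_ * _ + _ * _); (try by apply: eq_bigr => i _; rewrite ffunE);
    apply: eq_cumul_rec => // i; rewrite /b ffunE.
move=> f /andP[/eqP fT /eqP fF].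
have [i fi] : exists i, f i = true.
  apply: contrapT => h; apply: fF; apply/ffunP => i; rewrite ffunE.
  by apply/negbTE/negP => fi; apply: h; exists i.
have [j fj] : exists j, f j = false.
  apply: contrapT => h; apply: fT; apply/ffunP => j; rewrite ffunE.
  by apply: contrapT => /negP/negbTE fj; apply: h; exists j.
have n2 : (2 <= n)%N.
  case: n i j n0 chi c b f fT fF fi fj neq {free} => [|[|n]] // i j _ chi c b f _ _.
  by rewrite !ord1 => ->.
have := free n chi f n2; rewrite /kappa => ->; first by rewrite mulr0.
by exists i, j; rewrite fi fj.
Qed.

Lemma star_exp_scale (w : bool) (p1 p2 : A) (s : R[i]) :
  star P p1 = p1 -> star P p2 = p2 -> s^* = s ->
  star_exp P w (s *: (p1 + 'i *: p2)) =
  (s * (if w then - 'i else 'i)) *: p2 + s *: p1.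
Proof.
move=> h1 h2 hs; rewrite -scalerA -scalerDr [in RHS]addrC /star_exp.
by case: w; rewrite // starZ starD starZ h1 h2 hs conjCi.
Qed.

End Cumulants.

Theorem theorem2p4 (R : realType) (A : algType R[i]) (P : star_prob_space A)
    (cl cr : A) (hc : bicircular P cl cr) : r_diagonal P cl cr.
Proof.
case: hc => z1 [z2 [C [[sa1 sa2] free _ [[lim1 lim1'] [lim2 lim2']] [ecl ecr]]]].
move=> m chi z hz not_alt.
(* If an entry equals its own adjoint, both exponents are possible and [w] selects the exponent
   1. *)
pose w i := z i != entry (cl, cr) (chi i).
have zE i : z i = star_exp P (w i) (entry (cl, cr) (chi i)).
  by rewrite /w; case: eqP => //=; case: (hz i).
pose s : R[i] := (sqrtC 2)^-1.
have sR : s^* = s by apply: geC0_conj; rewrite invr_ge0 sqrtC_ge0 ler0n.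
have entryE t : entry (cl, cr) t = s *: (entry z1 t + 'i *: entry z2 t).
  by case: t => /=.
pose c i (e : bool) := if e then s * (if w i then - 'i else 'i) else s.
have -> : z = fun i => c i true *: entry z2 (chi i) + c i false *: entry z1 (chi i).
  by apply/funext => i; rewrite zE entryE star_exp_scale.
(* For [m = 0] the cumulant is 0 by convention. *)
have [m0|m0] := posnP m; first by subst m.
rewrite kappa_bifree //; have [m2|/eqP m2] := eqVneq m 2%N; last first.
  by rewrite lim1' // lim2' // !mulr0 addr0.
(* Both pairs have the same covariance [C], so it factors out and only the sum of the two
   coefficient products has to vanish. *)
subst m; rewrite lim1 lim2 -mulrDl !big_ord_recl !big_ord0 /= !mulr1.
have [ww|ww] := eqVneq (w ord0) (w (lift ord0 ord0)).
  rewrite /c ww mulrACA.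
  have -> : (if w (lift ord0 ord0) then - 'i else 'i) *
            (if w (lift ord0 ord0) then - 'i else 'i) = -1 :> R[i].
    by case: ifP; rewrite ?mulrNN -expr2 sqrCi.
  by rewrite mulrN1 addNr mul0r.
case: not_alt; split=> //.
(* The exponents must be read in the order given by [schi chi], hence the composition. *)
exists (size [seq i <- enum 'I_2 | chi i == Left]), (fun i => w (schi chi i)).
split.
- by rewrite size_filter (leq_trans (count_size _ _)) // size_enum_ord.
- have ord2 (i : 'I_2) : i = ord0 \/ i = lift ord0 ord0.
    by case: i => [[|[|i]] hi] //; [left|right]; apply: val_inj.
  (* With only two positions, unequal exponents alternate in either order, so injectivity of
     [schi chi] is all that is used about it. *)
  have neq (i j : 'I_2) : i != j -> w i != w j.
    by case: (ord2 i) (ord2 j) => -> [] -> //; rewrite ?eqxx // => _; rewrite eq_sym.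
  move=> i j ji; apply: neq; rewrite (inj_eq perm_inj).
  by apply/eqP => ij; move: ji; rewrite ij; apply: n_Sn.
- by move=> i; rewrite schi_left zE; case: (chi _).
Qed.
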